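(* For every $0<\varepsilon<1$ there is a deterministic $\mathrm{DistLocal}[\Delta^{O(1/\varepsilon)} + O(1/\varepsilon^2)\cdot\log^*(n)]$-algorithm for computing a $(1-\varepsilon)$-approximate maximum cardinality matching, i.e., a matching $M$ with $|M|\ge(1-\varepsilon)|M^*|$ where $M^*$ is a maximum cardinality matching.
   Context: In the DistLocal model, computation takes place on an undirected graph $G$ with $n$ vertices and maximum degree $\Delta$; each vertex is a processor whose local input includes its ID (distinct, bounded by a polynomial in $n$), its degree, $\Delta$, $n$, and its ports (numbered pointers to its neighbors). Computation proceeds in synchronous rounds; in each round every vertex receives messages from its neighbors, performs arbitrary local computation, and sends a message (of unbounded length) to each neighbor. After the last round each vertex computes its local output (here: which of its incident edges are in the matching). A $\mathrm{DistLocal}[r]$-algorithm uses $r$ rounds. *)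

(* Defs.v *)
From HB Require Import structures.
From mathcomp Require Import all_boot all_order all_algebra.
From mathcomp Require Import reals exp.
From mathcomp Require Import lra.
Set Implicit Arguments.
Unset Strict Implicit.
Unset Printing Implicit Defensive.
Import Order.TTheory GRing.Theory Num.Theory.

Record sgraph := SGraph {
  vertex :> finType;
  adj : rel vertex;
  adj_sym : symmetric adj;
  adj_irr : irreflexive adj }.

Section Graphs.
Variable G : sgraph.
Implicit Types (u v : G) (M : {set {set G}}).

Definition degree v : nat := #|[set u | adj v u]|.
Definition max_degree : nat := \max_(v : G) degree v.
Definition edges : {set {set G}} := [set [set u; v] | u in [set: G], v in [set v | adj u v]].
Definition matching M : Prop := M \subset edges /\ trivIset M.
Definition maximum_matching M : Prop :=
  matching M /\ forall M' : {set {set G}}, matching M' -> #|M'| <= #|M|.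

End Graphs.

(* The i-th entry of [ports v] is the neighbour reached through port i of v;
   ports are numbered from 0. *)
Record network (G : sgraph) := Network {
  vid : G -> nat;
  ports : G -> seq G;
  vid_inj : injective vid;
  ports_uniq : forall v, uniq (ports v);
  mem_ports : forall u v, (v \in ports u) = adj u v }.

(* A vertex does not see who sits behind a port: it knows its ports
   0, ..., in_degree - 1 by number only. *)
Record local_input := LocalInput {
  in_id : nat;
  in_degree : nat;
  in_max_degree : nat;
  in_order : nat }.

(* [send s i] is the message put on port i by a vertex in state s;
   [step s ms] is its next state when [nth _ ms i] was received on port i;
   [output s i] tells whether the edge at port i is selected. *)
Record algorithm := Algorithm {
  state : Type;
  message : Type;
  init : local_input -> state;
  send : state -> nat -> message;
  step : state -> seq message -> state;
  output : state -> pred nat }.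

Section Execution.
Variables (A : algorithm) (G : sgraph) (N : network G).

Definition port (u v : G) : nat := index v (ports N u).

Definition input (v : G) : local_input :=
  LocalInput (vid N v) (degree v) (max_degree G) #|G|.

Definition round (s : G -> state A) : G -> state A :=
  fun v => step (s v) [seq send (s u) (port u v) | u <- ports N v].

Definition run (t : nat) : G -> state A :=
  iter t round (fun v => init A (input v)).

(* Quantifying over both orientations of an edge makes its endpoints agree. *)
Definition outputs_edge_set (t : nat) (M : {set {set G}}) : Prop :=
  forall u v : G, adj u v -> output (run t u) (port u v) = ([set u; v] \in M).

End Execution.

Local Open Scope ring_scope.

Section LogStar.
Variable R : realType.
Implicit Types x : R.

Definition log2 x : R := ln x / ln 2.

Lemma log2_le x : log2 x <= Num.max 1 (x - 1).
Proof.
have ln2 : 0 < ln (2 : R) by rewrite ln_gt0 ?ltr1n.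
rewrite le_max /log2 !ler_pdivrMr // mul1r.
have [x2|x2] := leP x 2.
  have [x0|x0] := leP x 0; first by rewrite (ln0 x0) ltW.
  have -> // : ln x <= ln 2 by rewrite ler_ln ?posrE.
apply/orP; right.
have x0 : 0 < x by lra.
have -> : ln x = ln 2 + ln (x / 2).
  by rewrite -lnM ?posrE ?divr_gt0 // mulrC divfK // pnatr_eq0.
have h1 : ln (x / 2) <= x / 2 - 1.
  have := @le_ln1Dx R (x / 2 - 1); rewrite (addrC 1) subrK; apply; lra.
have h2 : 1 - 2^-1 <= ln (2 : R).
  have := @le_ln1Dx R (2^-1 - 1); rewrite (addrC 1) subrK lnV ?posrE // => h.
  have : - ln (2 : R) <= 2^-1 - 1 by apply: h; lra.
  lra.
nra.
Qed.

Lemma iter_log2_le1 x : exists k, iter k log2 x <= 1.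
Proof.
have H k : iter k log2 x <= Num.max 1 (x - k%:R).
  elim: k => [|k IH] /=; first by rewrite subr0 le_max lexx orbT.
  apply: le_trans (log2_le _) _.
  rewrite ge_max !le_max lexx /= -natr1.
  move: IH; rewrite le_max => /orP[h|h]; apply/orP; first by left; lra.
  by right; lra.
exists (Num.bound `|x|); apply: le_trans (H _) _.
rewrite ge_max lexx /=.
set y := `|x|; have hy : y < (Num.bound y)%:R by apply: archi_boundP; exact: normr_ge0.
have := ler_norm x; rewrite -/y; lra.
Qed.

Definition log_star x : nat := ex_minn (iter_log2_le1 x).

End LogStar.

(* Main.v *)
(* With k about 2/eps, Linial's colour reduction iterated log* n times gives a
   colouring with Delta^O(k) colours in which vertices at distance at most 4k get
   distinct colours; each iteration costs 4k rounds. Then 4k^2 sweeps over the colour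
   classes are made: when its turn comes, an unmatched vertex looks for an augmenting
   path with at most 2k vertices starting from it and flips it; simultaneous flips are
   disjoint because of the colouring. Let s and s* be the numbers of vertices matched
   by the current and by an optimal matching. The vertices X touched by a sweep
   hit every augmenting path with at most 2k vertices present at its start, whence
   k s* <= (k + 1) s + 2k |X|, while |X| is at most 2k times the growth of s. Hence
   s grows by more than s*/4k^2 in each sweep until (k + 1) s >= (k - 1) s*.

   Message passing is dealt with once and for all: a function of the vertices is
   computable in t rounds as soon as it factors through the view gathered by the
   full-information algorithm in t rounds, and such functions are closed under
   collecting their values along all walks of length at most l at the cost of l
   rounds. *)
Require Import Defs.
From mathcomp Require Import all_boot all_order all_algebra.
From mathcomp Require Import finfield.
From mathcomp Require Import boolp reals exp.
From mathcomp Require Import zify lra.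
Set Implicit Arguments.
Unset Strict Implicit.
Unset Printing Implicit Defensive.
Import Order.TTheory GRing.Theory Num.Theory.

(** Local computation is unrestricted in the model, so a vertex may choose classically; the choice
    depends on [P] and [x0] alone, hence only on what the vertex knows. *)
Definition pick_or (T : Type) (x0 : T) (P : T -> Prop) : T :=
  if pselect (exists x, P x) is left e then sval (cid e) else x0.

Lemma pick_orP (T : Type) (x0 : T) (P : T -> Prop) x : P x -> P (pick_or x0 P).
Proof.
rewrite /pick_or => Px; case: pselect => [e|[]]; last by exists x.
by case: (cid e).
Qed.

Lemma pick_or_default (T : Type) (x0 : T) (P : T -> Prop) :
  ~ (exists x, P x) -> pick_or x0 P = x0.
Proof. by rewrite /pick_or; case: pselect. Qed.

(** * Full-information views and locality *)

Inductive view := Leaf of local_input | Node of view & seq view.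

Fixpoint view_input (s : view) : local_input :=
  match s with Leaf i => i | Node s' _ => view_input s' end.

Definition collect (out : view -> pred nat) : algorithm :=
  @Algorithm view view Leaf (fun s _ => s) Node out.

Fixpoint views (G : sgraph) (N : network G) (t : nat) (v : G) : view :=
  if t is t'.+1 then Node (views N t' v) [seq views N t' u | u <- ports N v]
  else Leaf (input N v).

Lemma run_collect out (G : sgraph) (N : network G) t (v : G) :
  run (collect out) N t v = views N t v.
Proof.
elim: t v => // t IH v; rewrite [RHS]/= -IH -(eq_map IH).
by [].
Qed.

Lemma view_input_views (G : sgraph) (N : network G) t (v : G) :
  view_input (views N t v) = input N v.
Proof. by elim: t. Qed.

Definition netfun (X : Type) := forall G : sgraph, network G -> G -> X.

Definition local (X : Type) (t : nat) (f : netfun X) :=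
  exists F : view -> X, forall G (N : network G) v, f G N v = F (views N t v).

Section Local.
Variables X Y Z : Type.
Implicit Types (f : netfun X) (g : netfun Y).

Lemma local_vid : local 0 (fun G (N : network G) v => vid N v).
Proof. by exists (fun s => in_id (view_input s)). Qed.

Lemma local_map (h : X -> Y) t f :
  local t f -> local t (fun G N v => h (f G N v)).
Proof. by case=> F fE; exists (h \o F) => G N v /=; rewrite fE. Qed.

Lemma local_map2 (h : X -> Y -> Z) t f g : local t f -> local t g ->
  local t (fun G N v => h (f G N v) (g G N v)).
Proof.
case=> F fE [F' gE]; exists (fun s => h (F s) (F' s)) => G N v /=.
by rewrite fE gE.
Qed.

Lemma local_le t t' f : t <= t' -> local t f -> local t' f.
Proof.
move=> /subnK <-; elim: (t' - t) => // n IH /IH[F fE].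
by exists (fun s => if s is Node s' _ then F s' else F s) => G N v; rewrite fE.
Qed.

Lemma local_nbrs t f : local t f ->
  local t.+1 (fun G N v => [seq f G N u | u <- ports N v]).
Proof.
case=> F fE; exists (fun s => if s is Node _ ss then map F ss else [::]) => G N v.
by rewrite /= -map_comp; apply: eq_map => u; rewrite fE.
Qed.

End Local.

(** * Collecting values along walks *)

Section Walks.
Variables (X : Type) (G : sgraph).
Implicit Types (f : G -> X) (u v : G).

(** A vertex cannot name other vertices, so what it collects is the set of value lists along walks
    of at most [l] edges. *)
Definition walks l f v : seq X -> Prop :=
  fun z => exists w, [/\ path (@adj G) v w, size w <= l & z = map f (v :: w)].

(** The union over the neighbours is a [foldr] over a list of predicates because that list is
    exactly what arrives through the ports. *)
Lemma walksS (N : network G) l f v :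
  walks l.+1 f v =
  fun z => z = [:: f v] \/
    exists2 z', z = f v :: z' &
      foldr (fun S S' => fun z => S z \/ S' z) (fun=> False)
            [seq walks l f u | u <- ports N v] z'.
Proof.
have foldP s z : foldr (fun S S' => fun z => S z \/ S' z) (fun=> False)
    [seq walks l f u | u <- s] z <-> exists2 u, u \in s & walks l f u z.
  elim: s => [|u s IH] /=; first by split=> // -[].
  split=> [[uz|/IH[u' us uz]]|[u']].
  - by exists u; rewrite ?mem_head.
  - by exists u'; rewrite // in_cons us orbT.
  by rewrite in_cons => /predU1P[->|us uz]; [left|right; apply/IH; exists u'].
apply/funext => z; apply/propext; split.
  case=> -[|u w] [/= vw wl ->]; first by left.
  move: vw => /andP[vu uw]; right; exists (map f (u :: w)) => //.
  by apply/foldP; exists u; [rewrite mem_ports|exists w].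
case=> [->|[z' -> /foldP[u]]]; first by exists [::].
rewrite mem_ports => vu [w [uw wl ->]].
by exists (u :: w); rewrite /= vu.
Qed.

End Walks.

Lemma local_walks (X : Type) t l (f : netfun X) : local t f ->
  local (t + l) (fun G N v => walks l (f G N) v).
Proof.
move=> lf; elim: l => [|l IH].
  rewrite addn0; have [F FE] := local_map (fun x z => z = [:: x]) lf.
  exists F => G N v; rewrite -FE; apply/funext => z; apply/propext.
  by split=> [[[|? ?] []]|->] //; exists [::].
have ltl : t <= (t + l).+1 by lia.
rewrite addnS.
have := local_map2 (fun x Ss z => z = [:: x] \/ exists2 z', z = x :: z' &
   foldr (fun S S' => fun z => S z \/ S' z) (fun=> False) Ss z')
   (local_le ltl lf) (local_nbrs IH).
case=> F FE; exists F => G N v; rewrite -FE; exact: walksS.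
Qed.

(** * Matchings and alternating paths *)

Section Matchings.
Variable G : sgraph.
Implicit Types (m ms : G -> G) (u v w : G) (s : seq G) (M : {set {set G}}).

(* A matching is encoded by its partner map, whose fixed points are the
   unmatched vertices. *)
Definition pairing m := involutive m /\ forall v, m v != v -> adj v (m v).

Definition matched m : {set G} := [set v | m v != v].

(* Exchanging the partners along such a path matches all its vertices, so one
   only needs its vertex set to be closed under [m], not that it alternates. *)
Definition augmenting m v s :=
  [/\ path (@adj G) v s, uniq (v :: s), odd (size s), m v = v
    & forall u, u \in v :: s -> m u \in v :: s].

Section Gap.
Variables (m ms : G -> G) (k : nat) (X : {set G}).
Hypotheses (mP : pairing m) (msP : pairing ms).
Hypothesis Xhits : forall v s, augmenting m v s -> size s < k.*2 ->
  exists2 x, x \in X & x \in v :: s.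

(** The walk uses [ms] first because it is meant to start at a vertex free in [m]. At a fixed point
    it stays for one step and then retraces itself, whence [moving] below. *)
Fixpoint alt j v : G :=
  if j is i.+1 then (if odd i then m else ms) (alt i v) else v.

Definition moving j v := forall i, i < j -> alt i.+1 v != alt i v.

Lemma alt_inv j v : (if odd j then m else ms) (alt j.+1 v) = alt j v.
Proof. by rewrite /=; case: odd; [case: mP => mK _|case: msP => mK _]; rewrite mK. Qed.

Lemma moving_le i j v : i <= j -> moving j v -> moving i v.
Proof. by move=> ij mv a ai; apply: mv; apply: leq_trans ai ij. Qed.

(** Every step is an involution determined by the parity of its index, so two walks meeting at equal
    parity can be undone together until the shorter is back at [v]. If the walk from [w] had steps
    left, the last of them would be an [m]-step into [v], which [m] fixes. *)
Lemma alt_inj_parity a b v w : m v = v -> moving b w -> a <= b ->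
  odd a = odd b -> alt a v = alt b w -> a = b /\ v = w.
Proof.
move=> mv; elim: a b => [|a IH] [|b] mw //.
  move=> _ /= /esym/negbFE ob E.
  by have := mw b (leqnn _); rewrite -(alt_inv b w) -[alt b.+1 w]E ob mv eqxx.
rewrite ltnS => ab oab E.
have o : odd a = odd b by move: oab => /=; case: odd; case: odd.
have E' : alt a v = alt b w by rewrite -(alt_inv a v) -(alt_inv b w) E o.
by have [->->] := IH b (moving_le (leqnSn b) mw) ab o E'.
Qed.

(** Equal parities are excluded by [alt_inj_parity]. With different parities the same involution
    applies at both ends, so the coincidence moves inwards until it hits two consecutive positions,
    against [moving]. *)
Lemma alt_uniq j v : m v = v -> moving j v -> uniq (mkseq (alt^~ v) j.+1).
Proof.
move=> mv mj; apply/mkseq_uniqP.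
suff H d a b : b <= j -> b - a <= d -> a < b -> alt a v != alt b v.
  move=> a b; rewrite !inE !ltnS => aj bj E.
  case: (ltngtP a b) => // ab; first by have := H _ a b bj (leqnn _) ab; rewrite E eqxx.
  by have := H _ b a aj (leqnn _) ab; rewrite E eqxx.
elim/ltn_ind: d a b => d IH a [|b] // bj dab ab; apply/eqP => E.
have [o|o] := eqVneq (odd a) (odd b.+1).
  have [] := alt_inj_parity mv (moving_le bj mj) (ltnW ab) o E; lia.
have o' : odd a = odd b by move: o => /=; case: odd; case: odd.
have E' : alt a.+1 v = alt b v by rewrite -(alt_inv b v) -E /= o'.
have [ab'|ab'] := eqVneq a b.
  by have := mj b bj; rewrite -E ab' eqxx.
have ne : a.+1 != b by apply/eqP => h; move: o'; rewrite -h /=; case: odd.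
have := IH (d - 1) _ a.+1 b; rewrite E' eqxx => H; have : false by apply: H; lia.
by [].
Qed.

(** [m] pairs each odd position with the next one, except that the two ends [v] and [alt j v] are
    free, so the vertex set is closed under [m]. *)
Lemma alt_augmenting j v : m v = v -> odd j -> moving j v ->
  alt j.+1 v = alt j v -> augmenting m v (mkseq (fun i => alt i.+1 v) j).
Proof.
move=> mv oj mj Ej.
have sE : v :: mkseq (fun i => alt i.+1 v) j = mkseq (alt^~ v) j.+1.
  by rewrite /mkseq /= -[1]addn0 iotaDl -map_comp.
split=> //.
- apply/(pathP v) => i; rewrite size_mkseq => ij.
  rewrite nth_mkseq // sE nth_mkseq; last exact: ltnW.
  have := mj i ij => /=; case: odd; [by case: mP => _; apply|by case: msP => _; apply].
- by rewrite sE; exact: alt_uniq.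
- by rewrite size_mkseq.
move=> u; rewrite sE => /mapP[i]; rewrite mem_iota add0n leq0n /= ltnS => ij ->.
apply/mapP; case oi: (odd i).
  have [->|ne] := eqVneq i j.
    by exists j; rewrite ?mem_iota //= -[RHS]Ej /= oj.
  by exists i.+1; rewrite ?mem_iota /= ?oi //; lia.
case: i oi ij => [|i] oi ij; first by exists 0; rewrite // mem_iota.
exists i; first by rewrite mem_iota; lia.
by have := alt_inv i v; move: oi => /= /negbFE ->.
Qed.

Lemma matched_alt j v : m v = v -> ~~ odd j -> 0 < j -> moving j v ->
  alt j v \in matched m.
Proof.
case: j => // j mv /= /negPn oj _ mj; rewrite inE.
by have := mj j (leqnn _); rewrite -{1}(alt_inv j v) /= oj eq_sym; case: mP => mK _; rewrite !mK.
Qed.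

(* Each m-free vertex starts a path alternating between ms and m. The paths that
   stop within 2k steps end either at an ms-free vertex or, after an odd number of
   steps, at an m-free vertex, and then they meet X; each of the others uses k
   m-matched vertices at its even positions. Even positions of distinct paths are
   distinct vertices, which bounds the number of paths of each kind. *)
Lemma gap : k * #|matched ms| <= k.+1 * #|matched m| + k.*2 * #|X|.
Proof.
pose free v := m v == v.
have freeP v : free v -> m v = v by move/eqP.
pose mov j v := [forall i : 'I_j, alt i.+1 v != alt i v].
have movP j v : reflect (moving j v) (mov j v).
  by apply: (iffP forallP) => [h i ij|h i]; [exact: (h (Ordinal ij))|exact: h].
pose stops (o : bool) (v : G) := [exists j : 'I_(k.*2), [&& odd j == o, mov j v & alt j.+1 v == alt j v]].
pose A3 := [set v | free v && mov k.*2 v].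
pose A1 := [set v | free v && stops false v].
pose A2 := [set v | free v && stops true v].
have cover : ~: matched m \subset A1 :|: A2 :|: A3.
  apply/subsetP => v vF; move: vF; rewrite !in_set negbK -/(free v) => vF; rewrite vF /=.
  case: (boolP (mov _ v)) => [|/forallPn/= [i0 hi0]]; rewrite ?orbT // orbF.
  have ex : exists i, alt i.+1 v == alt i v by exists i0; rewrite negbK in hi0.
  have [j hj minj] := ex_minnP ex.
  have jk : j < k.*2 by apply: leq_ltn_trans (ltn_ord i0); apply: minj; rewrite negbK in hi0.
  have mj : mov j v.
    apply/movP => i ij; apply/negP => /minj; lia.
  case oj: (odd j); apply/orP; [right|left]; apply/existsP; exists (Ordinal jk);
  by apply/and3P; split; rewrite ?oj.
have c1 : #|A1| <= #|~: matched ms|.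
  have ch v : exists j, v \in A1 -> [/\ ~~ odd j, moving j v & alt j.+1 v = alt j v].
    case: (boolP (v \in A1)) => [|_]; last by exists 0.
    rewrite in_set => /andP[_ /existsP[j /and3P[/eqP oj /movP mj /eqP e]]].
    by exists j; rewrite oj.
  have [J JP] := choice ch.
  rewrite -(card_in_imset (f := fun v => alt (J v) v)); last first.
    move=> v w vA wA; have [ov mv _] := JP v vA; have [ow mw _] := JP w wA.
    move: (vA) (wA); rewrite !in_set => /andP[/freeP fv _] /andP[/freeP fw _] E.
    case/orP: (leq_total (J v) (J w)) => le.
      by apply: (alt_inj_parity fv mw le _ E).2; rewrite (negbTE ov) (negbTE ow).
    by symmetry; apply: (alt_inj_parity fw mv le _ (esym E)).2; rewrite (negbTE ov) (negbTE ow).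
  apply/subset_leq_card/subsetP => _ /imsetP[v vA ->].
  by have [ov _] := JP v vA; rewrite /= (negbTE ov) !inE => ->; rewrite eqxx.
have c2 : #|A2| <= #|X|.*2.
  (* A hit at an odd position is shifted one step back along [ms], so that all hits sit at even
     positions; this enlarges [X] by its image under [ms], which doubles the bound. *)
  have ch v : exists j, v \in A2 ->
      [/\ ~~ odd j, moving j v & (alt j v \in X) || (ms (alt j v) \in X)].
    case: (boolP (v \in A2)) => [|_]; last by exists 0.
    rewrite in_set => /andP[/freeP fv /existsP[j /and3P[/eqP oj /movP mj /eqP e]]].
    have [] := Xhits (alt_augmenting fv oj mj e); first by rewrite size_mkseq.
    move=> x xX.
    rewrite -/(mkseq (fun i => alt i.+1 v) j).
    have -> : v :: mkseq (fun i => alt i.+1 v) j = mkseq (alt^~ v) j.+1.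
      by rewrite /mkseq /= -[1]addn0 iotaDl -map_comp.
    case/mapP => i; rewrite mem_iota /= add0n ltnS => ij xE.
    case oi: (odd i); last first.
      by exists i => _; rewrite oi -xE xX; split=> //; apply: moving_le mj.
    case: i oi ij xE => // i oi ij xE.
    exists i => _; split; [by []|by apply: moving_le mj; exact: ltnW|].
    by move: xE oi => /= + /negbTE oi; rewrite oi => <-; rewrite xX orbT.
  have [J JP] := choice ch.
  rewrite -(card_in_imset (f := fun v => alt (J v) v)); last first.
    move=> v w vA wA; have [ov mv _] := JP v vA; have [ow mw _] := JP w wA.
    move: (vA) (wA); rewrite !in_set => /andP[/freeP fv _] /andP[/freeP fw _] E.
    case/orP: (leq_total (J v) (J w)) => le.
      by apply: (alt_inj_parity fv mw le _ E).2; rewrite (negbTE ov) (negbTE ow).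
    by symmetry; apply: (alt_inj_parity fw mv le _ (esym E)).2; rewrite (negbTE ov) (negbTE ow).
  apply: (@leq_trans #|X :|: ms @: X|); last first.
    rewrite -addnn; apply: leq_trans (leq_card_setU _ _) _.
    by rewrite leq_add2l leq_imset_card.
  apply/subset_leq_card/subsetP => _ /imsetP[v vA ->].
  have [_ _ /orP[h|h]] := JP v vA; rewrite inE; first by rewrite h.
  by apply/orP; right; apply/imsetP; exists (ms (alt (J v) v)); case: msP => // mK _; rewrite mK.
have c3 : k * #|A3| <= #|matched m|.
  rewrite -[k]card_ord -cardsT mulnC -cardsX.
  (* Only positions 2, 4, ..., 2k are counted: position 0 is free in [m]. *)
  have hi (i : 'I_k) : i.+1.*2 <= k.*2 by rewrite leq_double.
  rewrite -(card_in_imset (f := fun vi : G * 'I_k => alt vi.2.+1.*2 vi.1)); last first.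
    move=> [v i] [w j]; rewrite !in_setX !in_set /= !andbT.
    move=> /andP[/freeP fv /movP mv] /andP[/freeP fw /movP mw] E.
    case/orP: (leq_total i j) => le.
      have le2 : i.+1.*2 <= j.+1.*2 by rewrite leq_double.
      have [|e ->] := alt_inj_parity fv (moving_le (hi j) mw) le2 _ E.
        by rewrite !odd_double.
      by congr pair; apply: val_inj => /=; lia.
    have le2 : j.+1.*2 <= i.+1.*2 by rewrite leq_double.
    have [|e ->] := alt_inj_parity fw (moving_le (hi i) mv) le2 _ (esym E).
      by rewrite !odd_double.
    by congr pair; apply: val_inj => /=; lia.
  apply/subset_leq_card/subsetP => _ /imsetP[[v i] vi ->].
  have /andP[/freeP fv /movP mv] : free v && mov k.*2 v.
    by move: vi; rewrite in_setX !in_set andbT.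
  by apply: matched_alt => //; [rewrite odd_double|apply: moving_le mv].
have cA : #|~: matched m| <= #|A1| + #|A2| + #|A3|.
  apply: leq_trans (subset_leq_card cover) _.
  by apply: leq_trans (leq_card_setU _ _) _; rewrite leq_add2r leq_card_setU.
have h1 := cardsC (matched m); have h2 := cardsC (matched ms).
have : #|matched ms| <= #|matched m| + #|A3| + #|X|.*2 by lia.
rewrite -(leq_pmul2l (m := k.+1)) //; nia.
Qed.

End Gap.

(** * Partner maps and edge sets *)

Lemma set2_inj_r u v w : u != v -> u != w -> [set u; v] = [set u; w] -> v = w.
Proof.
move=> uv uw E; have : v \in [set u; w] by rewrite -E !inE eqxx orbT.
by rewrite !inE eq_sym (negbTE uv) => /eqP.
Qed.

Lemma adj_neq u v : adj u v -> u != v.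
Proof. by apply: contraTneq => ->; rewrite adj_irr. Qed.

Lemma mem_edges u v : ([set u; v] \in edges G) = adj u v.
Proof.
apply/imset2P/idP => [[a b _]|uv]; last by exists u v; rewrite ?inE.
rewrite inE => ab E.
have := adj_neq ab; have : a \in [set u; v] by rewrite E !inE eqxx.
have : b \in [set u; v] by rewrite E !inE eqxx orbT.
rewrite !inE => /orP[]/eqP eb /orP[]/eqP ea; move: ab; rewrite ea eb ?eqxx //.
by rewrite adj_sym.
Qed.

Lemma card_cover_matching M : matching M -> #|cover M| = #|M|.*2.
Proof.
move=> [/subsetP ME trM]; rewrite -muln2; apply: card_uniform_partition => [e /ME|].
  by case/imset2P => a b _; rewrite inE => /adj_neq ab ->; rewrite cards2 ab.
apply/and3P; split=> //; apply/negP => /ME/imset2P[a b _ _] /setP/(_ a).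
by rewrite !inE eqxx.
Qed.

Definition partner M v : G := odflt v [pick u | [set v; u] \in M].

Lemma partner_eq M u v : matching M -> [set u; v] \in M -> partner M u = v.
Proof.
move=> [/subsetP ME /trivIsetP trM] uvM; rewrite /partner; case: pickP => [w|/(_ v)]; last by rewrite uvM.
move=> uwM /=; have := ME _ uwM; have := ME _ uvM; rewrite !mem_edges.
move=> /adj_neq uv /adj_neq uw; apply: (@set2_inj_r u) => //; apply/eqP.
apply: contraT => /(trM _ _ uwM uvM)/disjoint_setI0/setP/(_ u).
by rewrite !inE eqxx.
Qed.

Lemma pairing_partner M : matching M -> pairing (partner M).
Proof.
move=> MM; split=> v.
  rewrite {2}/partner; case: pickP => [u vu|h] /=.
    by rewrite (partner_eq (v := v)) // setUC.
  by rewrite /partner; case: pickP => // u; rewrite h.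
rewrite /partner; case: pickP => /= [u vu _|_]; last by rewrite eqxx.
by rewrite -mem_edges; case: MM => /subsetP ME _; exact: ME.
Qed.

Lemma matched_partner M : matching M -> matched (partner M) = cover M.
Proof.
move=> MM; have [/subsetP ME _] := MM; apply/setP => v; rewrite inE.
apply/idP/bigcupP => [|[e eM ve]].
  rewrite /partner; case: pickP => /= [u vu _|_]; last by rewrite eqxx.
  by exists [set v; u]; rewrite // !inE eqxx.
have /imset2P[a b _] := ME _ eM; rewrite inE => /adj_neq ab eE.
move: ve; rewrite eE !inE => /orP[]/eqP->.
  by rewrite (partner_eq (v := b)) -?eE // eq_sym.
by rewrite (partner_eq (v := a)) // setUC -eE.
Qed.

Definition pairs m : {set {set G}} := [set [set v; m v] | v in matched m].

Lemma mem_pairs m u v : pairing m -> u != v -> ([set u; v] \in pairs m) = (m u == v).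
Proof.
move=> [mK _] uv; apply/imsetP/eqP => [[a]|E]; last first.
  by exists u; rewrite ?inE E // eq_sym.
rewrite inE => ma E.
have [ua|ua] := eqVneq u a.
  by subst a; symmetry; apply: set2_inj_r E => //; rewrite eq_sym.
have : u \in [set a; m a] by rewrite -E !inE eqxx.
rewrite !inE (negbTE ua) /= => /eqP um; rewrite um mK.
move: E; rewrite um [RHS]setUC => E; symmetry; apply: set2_inj_r E => //.
by rewrite -um.
Qed.

Lemma matching_pairs m : pairing m -> matching (pairs m).
Proof.
move=> mP; have [mK madj] := mP; split.
  by apply/subsetP => _ /imsetP[v vm ->]; move: vm; rewrite inE mem_edges; exact: madj.
apply/trivIsetP => _ _ /imsetP[u _ ->] /imsetP[v _ ->] ne.
rewrite -setI_eq0; apply/eqP/setP => x; rewrite !inE; apply/negP => /andP[].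
move=> /orP[]/eqP-> /orP[]/eqP E; move: ne; rewrite ?E ?mK ?eqxx //.
- by rewrite setUC eqxx.
- by rewrite -E mK setUC eqxx.
by rewrite (can_inj mK E) eqxx.
Qed.

Lemma cover_pairs m : pairing m -> cover (pairs m) = matched m.
Proof.
move=> [mK _]; apply/setP => v; apply/bigcupP/idP => [[_ /imsetP[u um ->]]|vm].
  rewrite !inE => /orP[]/eqP->; move: um; rewrite inE // mK eq_sym //.
by exists [set v; m v]; [apply: imset_f|rewrite !inE eqxx].
Qed.

End Matchings.

(** * Linial's colour reduction *)

Lemma card_bigcup_le (I T : finType) (P : {pred I}) (A : I -> {set T}) :
  #|\bigcup_(i in P) A i| <= \sum_(i in P) #|A i|.
Proof.
elim/big_ind2: _ => // [|B n C n' Bn Cn]; first by rewrite cards0.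
by apply: leq_trans (leq_card_setU _ _) _; exact: leq_add.
Qed.

(** The bit length of a point together with a value in a field with more than [2 ^ d * a]
    elements. *)
Definition linial_bits (d a : nat) := (d + (trunc_log 2 a).+1).*2.

Lemma linial_bits_gt0 d a : 0 < linial_bits d a.
Proof. by rewrite /linial_bits addnS. Qed.

(* Reed-Solomon: a colour is read as the polynomial whose coefficients are its
   binary digits, and distinct polynomials of size at most [a] agree at fewer
   than [a] points of the field with 2 ^ e elements. *)
Lemma separating_functions e a : 0 < e -> exists (F : finType) (h : nat -> F -> F),
  #|F| = 2 ^ e /\ forall c c', c < 2 ^ a -> c' < 2 ^ a -> c != c' ->
    #|[set x | h c x == h c' x]| < a.
Proof.
move=> e0; have [F _ cF] := PrimePowerField (isT : prime 2) e0.
pose P c : {poly F} := (\poly_(i < a) (odd (c %/ 2 ^ i)%N)%:R)%R.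
exists F, (fun c x => (P c).[x]%R); split=> // c c' ca c'a ne.
have digits b x y : x < 2 ^ b -> y < 2 ^ b ->
    (forall i, i < b -> odd (x %/ 2 ^ i) = odd (y %/ 2 ^ i)) -> x = y.
  elim: b x y => [|b IH] x y; first by rewrite expn0 !ltnS !leqn0 => /eqP-> /eqP->.
  rewrite expnS => xb yb E.
  have -> : x = odd x + (x %/ 2).*2 by rewrite divn2 odd_double_half.
  have -> : y = odd y + (y %/ 2).*2 by rewrite divn2 odd_double_half.
  have /= := E 0 isT; rewrite expn0 !divn1 => ->; congr (_ + _.*2).
  apply: IH; rewrite ?ltn_divLR // 1?mulnC //.
  by move=> i ib; rewrite -!divnMA -expnS E.
have Pne : (P c - P c' != 0)%R.
  rewrite subr_eq0; apply: contra ne => /eqP PE; apply/eqP.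
  apply: (digits a) => // i ia.
  have := congr1 (fun p : {poly F} => p`_i)%R PE; rewrite !coef_poly ia.
  case: odd; case: odd => //= /eqP; rewrite ?oner_eq0 // eq_sym oner_eq0 //.
have sP : size (P c - P c')%R <= a.
  apply: leq_trans (size_polyD _ _) _; rewrite size_polyN geq_max.
  by rewrite !size_poly.
apply: leq_trans sP; rewrite cardE; apply: max_poly_roots => //.
  apply/allP => x; rewrite mem_enum inE => /eqP E.
  by rewrite /root !hornerE E subrr.
exact: enum_uniq.
Qed.

(** The function of each of the at most [2 ^ d] neighbours agrees with that of [v] at fewer than [a]
    points, so some point separates [v] from all of them; this point and the value there form the
    new colour. [L] sees only the own colour and the set of neighbouring ones, which makes the step
    local. *)
Lemma linial_step d a : exists L : nat -> (nat -> Prop) -> nat,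
  forall (T : finType) (nb : rel T) (col : T -> nat), symmetric nb ->
    (forall v, #|[set u | nb v u]| <= 2 ^ d) -> (forall v, col v < 2 ^ a) ->
    (forall u v, nb u v -> u != v -> col u != col v) ->
    let col' v := L (col v) (fun c => exists2 u, nb v u & c = col u) in
    (forall v, col' v < 2 ^ linial_bits d a) /\
    (forall u v, nb u v -> u != v -> col' u != col' v).
Proof.
set e := d + (trunc_log 2 a).+1.
have e0 : 0 < e by rewrite /e addnS.
have [F [h [cF hP]]] := separating_functions a e0.
have x0 : F by apply: (@enum_val F predT (cast_ord (esym cF) (Ordinal (_ : 0 < 2 ^ e)))); rewrite expn_gt0.
(* The condition [c' != c] skips the vertex itself, as [nb] will be a ball containing its centre. *)
pose good c (S : nat -> Prop) x := forall c', S c' -> c' != c -> h c x != h c' x.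
pose X c S := pick_or x0 (good c S).
exists (fun c S => nat_of_ord (enum_rank (X c S, h c (X c S)))).
move=> T nb col sym deg colb colp /=; split=> [v|u v uv ne].
  apply: leq_trans (ltn_ord _) _; rewrite card_prod cF -expnD addnn.
  by rewrite /linial_bits.
have goodX w : good (col w) (fun c => exists2 u, nb w u & c = col u)
                 (X (col w) (fun c => exists2 u, nb w u & c = col u)).
  pose bad := \bigcup_(u in [set u | nb w u && (u != w)]) [set x | h (col w) x == h (col u) x].
  have cbad : #|bad| < #|F|.
    have h1 : #|bad| <= #|[set u | nb w u]| * a.
      apply: leq_trans (_ : \sum_(u in [set u | nb w u && (u != w)]) a <= _).
        apply: leq_trans (card_bigcup_le _ _) _.
        apply: leq_sum => t; rewrite inE => /andP[wt tw].
        by apply/ltnW/hP => //; apply: colp => //; rewrite eq_sym.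
      rewrite sum_nat_const leq_mul2r; apply/orP; right.
      by apply/subset_leq_card/subsetP => t; rewrite !inE => /andP[].
    apply: leq_ltn_trans h1 _; apply: leq_ltn_trans (leq_mul (deg w) (leqnn a)) _.
    by rewrite cF /e expnD ltn_pmul2l ?expn_gt0 // trunc_log_ltn.
  have [x xbad] : exists x, x \notin bad.
    apply/existsP; rewrite -negb_forall; apply: contraL cbad => /forallP all.
    by rewrite -leqNgt -cardsT; apply/subset_leq_card/subsetP => x _; apply: all.
  apply: pick_orP (x) _ => _ [t wt ->] ne'; apply: contra xbad => E.
  apply/bigcupP; exists t; rewrite inE // wt.
  by apply: contraNneq ne' => ->.
apply/negP => /eqP/val_inj/enum_rank_inj[E1 E2].
have cvu : col v != col u by rewrite eq_sym colp.
have := goodX u (col v) (ex_intro2 _ _ v uv erefl) cvu.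
by rewrite E2 E1 eqxx.
Qed.

(** * Balls in the graph metric *)

Section Balls.
Variable G : sgraph.
Implicit Types u v w : G.

Fixpoint ball l v : {set G} :=
  if l is l'.+1 then v |: \bigcup_(u in [set u | adj v u]) ball l' u else [set v].

Lemma ballP l v u :
  reflect (exists s, [/\ path (@adj G) v s, size s <= l & last v s = u]) (u \in ball l v).
Proof.
apply: (iffP idP) => [|[s []]].
  elim: l v => [|l IH] v /=; first by rewrite inE => /eqP->; exists [::].
  rewrite !inE => /predU1P[->|/bigcupP[w]]; first by exists [::].
  by rewrite inE => vw /IH[s [ws sl <-]]; exists (w :: s); rewrite /= vw.
elim: l v s => [|l IH] v [|w s] //=; rewrite ?inE; do ?by move=> _ _ ->; rewrite eqxx.
move=> /andP[vw ws] sl su; apply/orP; right; apply/bigcupP; exists w; rewrite ?inE //.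
exact: IH ws _ _.
Qed.

Lemma ball_sym l : symmetric (fun u v => v \in ball l u).
Proof.
suff H u v : v \in ball l u -> u \in ball l v by move=> u v; apply/idP/idP; exact: H.
move=> /ballP[s [us sl <-]]; apply/ballP; exists (rev (belast u s)).
rewrite rev_path size_rev size_belast; split=> //.
  by rewrite (eq_path (e' := @adj G)) // => x y; rewrite adj_sym.
by case: s {us sl} => //= w s; rewrite rev_cons last_rcons.
Qed.

Lemma ball_trans l1 l2 u v w : v \in ball l1 u -> w \in ball l2 v -> w \in ball (l1 + l2) u.
Proof.
move=> /ballP[s [us sl sv]] /ballP[t [vt tl <-]]; apply/ballP; exists (s ++ t).
by rewrite cat_path us sv vt size_cat leq_add // last_cat sv.
Qed.

Lemma path_ball l v s : path (@adj G) v s -> size s <= l -> {subset v :: s <= ball l v}.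
Proof.
move=> + + u us; case/splitPl: us => s1 s2 su vs sl; apply/ballP; exists s1.
move: vs; rewrite cat_path => /andP[-> _]; split=> //.
by apply: leq_trans sl; rewrite size_cat leq_addr.
Qed.

Lemma card_ball l v : #|ball l v| <= (max_degree G).+1 ^ l.
Proof.
elim: l v => [|l IH] v; first by rewrite /= cards1.
apply: leq_trans (leq_card_setU _ _) _; rewrite cards1.
have : #|\bigcup_(u in [set u | adj v u]) ball l u| <= max_degree G * (max_degree G).+1 ^ l.
  apply: leq_trans (card_bigcup_le _ _) _.
  apply: (@leq_trans (\sum_(u in [set u | adj v u]) (max_degree G).+1 ^ l)).
    by apply: leq_sum => u _; exact: IH.
  by rewrite sum_nat_const leq_mul2r (leq_bigmax v) orbT.
have : 0 < (max_degree G).+1 ^ l by rewrite expn_gt0.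
by rewrite expnS mulSn; move: (_ ^ l) (_ * _) => x y x0 le; rewrite leq_add.
Qed.

End Balls.

(** * Iterating the colour reduction in a network *)

Section Coloring.
Variables (L : nat -> nat -> (nat -> Prop) -> nat) (bits : nat -> nat) (rho d : nat).

(** The last value along a walk is the colour of its endpoint, so the collected colours are those of
    the ball of radius [rho]. *)
Fixpoint coloring i : netfun nat :=
  if i is i'.+1 then fun G N v =>
    L (bits i') (coloring i' N v)
      (fun c => exists2 z, walks rho (@coloring i' G N) v z & c = last 0 z)
  else fun G N v => vid N v.

Lemma local_coloring i : local (i * rho) (coloring i).
Proof.
elim: i => [|i IH]; first exact: local_vid.
rewrite mulSn addnC.
have le : i * rho <= i * rho + rho by rewrite leq_addr.
exact: (local_map2 (fun c S => L (bits i) c (fun c => exists2 z, S z & c = last 0 z))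
         (local_le le IH) (local_walks rho IH)).
Qed.

Hypothesis LP : forall a (T : finType) (nb : rel T) (col : T -> nat), symmetric nb ->
    (forall v, #|[set u | nb v u]| <= 2 ^ d) -> (forall v, col v < 2 ^ a) ->
    (forall u v, nb u v -> u != v -> col u != col v) ->
    let col' v := L a (col v) (fun c => exists2 u, nb v u & c = col u) in
    (forall v, col' v < 2 ^ linial_bits d a) /\
    (forall u v, nb u v -> u != v -> col' u != col' v).
Hypothesis bitsS : forall i, bits i.+1 = linial_bits d (bits i).

Lemma coloringP (G : sgraph) (N : network G) i :
  (forall v, vid N v < 2 ^ bits 0) -> (forall v : G, #|ball rho v| <= 2 ^ d) ->
  (forall v, coloring i N v < 2 ^ bits i) /\
  (forall u v, v \in ball rho u -> u != v -> coloring i N u != coloring i N v).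
Proof.
move=> vidb deg; elim: i => [|i [IHb IHp]] /=.
  by split=> // u v _; rewrite (inj_eq (@vid_inj _ N)).
have degs (v : G) : #|[set u | u \in ball rho v]| <= 2 ^ d.
  by rewrite cardsE; exact: deg.
have E (v : G) : (fun c => exists2 z, walks rho (@coloring i G N) v z & c = last 0 z) =
    (fun c => exists2 u, u \in ball rho v & c = coloring i N u).
  apply/funext => c; apply/propext; split=> [[z [s [vs sl ->]] ->]|[u /ballP[s [vs sl <-]] ->]].
    by exists (last v s); rewrite /= ?last_map //; apply/ballP; exists s.
  by exists (map (coloring i N) (v :: s)); [exists s|rewrite /= last_map].
rewrite bitsS.
have [hb hp] := LP (nb := fun v u => u \in ball rho v) (@ball_sym G rho) degs IHb IHp.
by split=> [v|u v uv ne]; rewrite !E; [exact: hb|exact: hp].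
Qed.

End Coloring.

(** * Exchanging partners along a path *)

Section Flip.
Variable T : eqType.
Implicit Types (s : seq T) (x : T).

(** Positions 0 and 1, 2 and 3, and so on are paired, which on a path of even order is its perfect
    matching. *)
Definition flip s x : T :=
  let i := index x s in nth x s (if odd i then i.-1 else i.+1).

Section FlipEven.
Variables (s : seq T) (x : T).
Hypotheses (us : uniq s) (os : ~~ odd (size s)) (xs : x \in s).

Let i := index x s.
Let j := if odd i then i.-1 else i.+1.

Let lt_i : i < size s. Proof. by rewrite index_mem. Qed.

Let lt_j : j < size s.
Proof.
rewrite /j; case: ifP => oi; first exact: leq_ltn_trans (leq_pred _) lt_i.
rewrite ltn_neqAle lt_i andbT; apply: contraNneq os => <- /=; by rewrite oi.
Qed.

Lemma mem_flip : flip s x \in s. Proof. exact: mem_nth. Qed.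

Lemma flip_neq : flip s x != x.
Proof.
rewrite -{2}(nth_index x xs) nth_uniq //.
by rewrite -/i /j; case: ifP; case: (i) => //= n _; lia.
Qed.

Lemma flipK : flip s (flip s x) = x.
Proof.
rewrite {1}/flip index_uniq // -[RHS](nth_index x xs) -/i -/j.
have -> : (if odd j then j.-1 else j.+1) = i.
  by rewrite /j; case: (boolP (odd i)); case: (i) => //= n; case: (odd n).
exact: set_nth_default.
Qed.

End FlipEven.

Lemma flip_path (e : rel T) v s x : symmetric e -> path e v s -> odd (size s) ->
  x \in v :: s -> e x (flip (v :: s) x).
Proof.
move=> sym /(pathP x) ev os xs; rewrite /flip; set i := index x (v :: s).
have lt_i : i < (size s).+1 by rewrite index_mem.
rewrite -{1}(nth_index x xs) -/i; case: ifP => oi.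
  by case: (i) oi lt_i => // n _ lt_n; rewrite sym; exact: ev.
apply: ev; rewrite ltn_neqAle -ltnS lt_i andbT.
by apply: contraTneq os => <-; rewrite oi.
Qed.

End Flip.

(** Lets the algorithm flip lists of identifiers while the proof flips lists of vertices. *)
Lemma flip_map (T U : eqType) (f : T -> U) s x : injective f ->
  flip (map f s) (f x) = f (flip s x).
Proof.
move=> fI; rewrite /flip index_map //; move: (if _ then _ else _) => i.
have [lt|le] := ltnP i (size s); first exact: nth_map.
by rewrite !nth_default ?size_map.
Qed.

(** * Proposals and one augmentation step *)

Definition augmenting_records (z : seq (nat * nat)) : bool :=
  [&& uniq (map fst z), ~~ odd (size z), (head (0, 0) z).1 == (head (0, 0) z).2
    & all (fun r => r.2 \in map fst z) z].

Section Step.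
Variables (G : sgraph) (N : network G) (k c : nat) (col st : G -> nat).

(* The empty list stands for no proposal. *)
Definition proposal (v : G) : seq nat :=
  if col v == c then
    pick_or [::] (fun P => exists z,
      [/\ walks k.*2 (fun u => (vid N u, st u)) v z, augmenting_records z
        & P = map fst z])
  else [::].

(** The last entry along a walk is the proposal of its endpoint: [w] looks within distance 2k for a
    proposal that contains it and otherwise keeps its partner. *)
Definition new_partner (w : G) : nat :=
  pick_or (st w) (fun j => exists z,
    [/\ walks k.*2 proposal w z, vid N w \in last [::] z
      & j = flip (last [::] z) (vid N w)]).

Variable m : G -> G.
Hypotheses (mP : pairing m) (stE : forall v, st v = vid N (m v)).
Hypothesis colP : forall u v, v \in ball (k.*2 + k.*2) u -> u != v -> col u != col v.

Let vidI := @vid_inj G N.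

(** Adjacency comes from the walk itself; the records, holding the identifiers of a vertex and its
    partner, reveal the rest. *)
Lemma augmenting_recordsP v s : path (@adj G) v s ->
  augmenting_records [seq (vid N u, st u) | u <- v :: s] <-> augmenting m v s.
Proof.
have fstE : map fst [seq (vid N u, st u) | u <- v :: s] = map (vid N) (v :: s).
  by rewrite -map_comp; apply: eq_map.
move=> vs; rewrite /augmenting_records fstE (map_inj_uniq vidI) size_map.
have allE : all (fun r => r.2 \in map (vid N) (v :: s)) [seq (vid N u, st u) | u <- v :: s] <->
    forall u, u \in v :: s -> m u \in v :: s.
  rewrite all_map; split=> [/allP h u /h /=|h]; first by rewrite stE (mem_map vidI (v :: s)).
  by apply/allP => u /h us; rewrite /= stE (mem_map vidI (v :: s)).
split=> [/and4P[us os /eqP mv /allE cl]|[_ us os mv cl]].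
  by split=> //; [rewrite -[odd _]negbK|apply: vidI; rewrite -stE].
apply/and4P; split=> //; [by rewrite /= negbK|by rewrite /= stE mv|exact/allE].
Qed.

Lemma proposalP v : proposal v = [::] \/
  exists s, [/\ col v = c, augmenting m v s, size s < k.*2
              & proposal v = map (vid N) (v :: s)].
Proof.
rewrite /proposal; case: eqP => [cv|]; last by left.
set Q := (fun P : seq nat => _); have [[P QP]|nQ] := pselect (exists P, Q P); last first.
  by left; exact: pick_or_default.
have [z [[s [vs sl ->]] aug PE]] := pick_orP [::] QP.
right; exists s; have augs := (augmenting_recordsP vs).1 aug.
split=> //; last by rewrite PE -map_comp; apply: eq_map.
(* [walks] allows 2k edges, but the number of edges is odd, so the path has at most 2k vertices. *)
have [_ _ os _ _] := augs; rewrite ltn_neqAle sl andbT.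
by apply: contraTneq os => ->; rewrite odd_double.
Qed.

Lemma proposal_neq0 v s : col v = c -> augmenting m v s -> size s < k.*2 ->
  proposal v != [::].
Proof.
move=> cv aug sk; have [vs _ _ _ _] := aug.
rewrite /proposal cv eqxx; set Q := (fun P : seq nat => _).
have [|z [[t [_ _ ->]] _ ->]] // := @pick_orP _ [::] Q (map (vid N) (v :: s)).
exists [seq (vid N u, st u) | u <- v :: s]; split; last by rewrite -map_comp; apply: eq_map.
  by exists s; rewrite ltnW.
exact/augmenting_recordsP.
Qed.

Definition covers v s w := proposal v = map (vid N) (v :: s) /\ w \in v :: s.

Lemma coversP v s w : covers v s w ->
  [/\ col v = c, augmenting m v s, size s < k.*2 & w \in ball k.*2 v].
Proof.
move=> [E ws]; case: (proposalP v) => [E'|[t [cv aug tk E']]]; first by rewrite E' in E.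
have ts : t = s.
  by move: E; rewrite E' => -[] /(inj_map vidI).
subst t; split=> //; have [vs _ _ _ _] := aug.
exact: path_ball vs (ltnW tk) _ ws.
Qed.

(** Both proposers are within 2k of [w], hence within 4k of each other, and they share the colour
    [c]; so they coincide. *)
Lemma covers_inj v s v' s' w : covers v s w -> covers v' s' w -> v = v' /\ s = s'.
Proof.
move=> cov cov'; have [cv _ _ bv] := coversP cov; have [cv' _ _ bv'] := coversP cov'.
have vv : v = v'.
  apply/eqP; apply: contraT => ne.
  have := colP _ ne; rewrite cv cv' eqxx; apply.
  by apply: ball_trans bv _; rewrite ball_sym.
subst v'; split=> //; case: cov cov' => E _ [E' _].
by move: E; rewrite E' => -[] /(inj_map vidI).
Qed.

Lemma new_partner_covered v s w : covers v s w ->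
  new_partner w = vid N (flip (v :: s) w).
Proof.
move=> cov; have [_ _ _ wv] := coversP cov; have [pv ws] := cov.
rewrite /new_partner; set Q := (fun j : nat => _).
have Qz : Q (flip (map (vid N) (v :: s)) (vid N w)).
  have /ballP[t [wt tl tv]] : v \in ball k.*2 w by rewrite -ball_sym.
  exists (map proposal (w :: t)); split; first by exists t.
    by rewrite /= last_map tv pv mem_map.
  by rewrite /= last_map tv pv.
have [z [[t [wt tl ->]] + ->]] := pick_orP (st w) Qz.
rewrite /= last_map; set u := last w t => wu.
case: (proposalP u) => [E|[s' [_ _ _ E]]]; first by rewrite E in wu.
have cov' : covers u s' w by split=> //; move: wu; rewrite E mem_map.
by have [<- _] := covers_inj cov cov'; rewrite pv flip_map.
Qed.

Lemma new_partner_uncovered w : (forall v s, ~ covers v s w) -> new_partner w = st w.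
Proof.
move=> ncov; apply: pick_or_default => -[j [z [[t [wt tl ->]] + _]]].
rewrite /= last_map; set u := last w t => wu.
case: (proposalP u) => [E|[s' [_ _ _ E]]]; first by rewrite E in wu.
by apply: (ncov u s'); split=> //; move: wu; rewrite E mem_map.
Qed.

Lemma covered_dec w : (exists v s, covers v s w) \/ (forall v s, ~ covers v s w).
Proof.
have [h|h] := pselect (exists v s, covers v s w); first by left.
by right=> v s cov; apply: h; exists v, s.
Qed.

Lemma new_partner_neq v s w : covers v s w -> new_partner w != vid N w.
Proof.
move=> cov; rewrite (new_partner_covered cov) (inj_eq vidI).
have [_ [_ us os _ _] _ _] := coversP cov; have [_ ws] := cov.
by apply: flip_neq => //=; rewrite negbK.
Qed.

(** On a proposed path the partners are exchanged, elsewhere they are kept; the two parts fit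
    because a proposed path is closed under [m], so no old partnership crosses its boundary. *)
Lemma new_partner_pairing : exists2 m', pairing m' & forall v, new_partner v = vid N (m' v).
Proof.
have [mK madj] := mP.
have ex w : exists y, new_partner w = vid N y.
  have [[v [s cov]]|ncov] := covered_dec w.
    by exists (flip (v :: s) w); exact: new_partner_covered.
  by exists (m w); rewrite new_partner_uncovered.
have [m' m'E] := choice ex.
have m'cov v s w : covers v s w -> m' w = flip (v :: s) w.
  by move=> cov; apply: vidI; rewrite -m'E; exact: new_partner_covered.
have m'unc w : (forall v s, ~ covers v s w) -> m' w = m w.
  by move=> ncov; apply: vidI; rewrite -m'E new_partner_uncovered.
exists m' => //; split=> w.
  have [[v [s cov]]|ncov] := covered_dec w.
    have [_ [_ us os _ _] _ _] := coversP cov; have [pv ws] := cov.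
    have os' : ~~ odd (size (v :: s)) by rewrite /= negbK.
    rewrite (m'cov _ _ _ cov) (m'cov v s) ?flipK //.
    by split=> //; exact: mem_flip.
  rewrite (m'unc _ ncov) m'unc ?mK // => v s cov; apply: (ncov v s).
  have [_ [_ _ _ _ cl] _ _] := coversP cov; have [pv ws] := cov.
  by split=> //; rewrite -(mK w); exact: cl.
have [[v [s cov]]|ncov] := covered_dec w; last by rewrite (m'unc _ ncov); exact: madj.
have [_ [vs _ os _ _] _ _] := coversP cov; have [pv ws] := cov.
by rewrite (m'cov _ _ _ cov) => _; apply: flip_path => //; exact: adj_sym.
Qed.

Lemma new_partner_changed v s : col v = c -> augmenting m v s -> size s < k.*2 ->
  new_partner v != st v.
Proof.
move=> cv aug sk; have [_ _ _ mv _] := aug; rewrite stE mv.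
have := proposal_neq0 cv aug sk.
case: (proposalP v) => [->//|[t [_ _ _ E]] _].
by apply: (@new_partner_neq v t); split; rewrite ?mem_head.
Qed.

Let S (f : G -> nat) := [set v | f v != vid N v].

(** Every proposer was free and becomes matched while no matched vertex becomes free, so the growth
    is at least the number of proposers; each proposal changes at most 2k vertices. *)
Lemma card_changed : #|S st| <= #|S new_partner| /\
  #|[set w | new_partner w != st w]| <= k.*2 * (#|S new_partner| - #|S st|).
Proof.
pose F := [set v | proposal v != [::]].
have FP v : v \in F -> exists s, [/\ augmenting m v s, size s < k.*2 & proposal v = map (vid N) (v :: s)].
  by rewrite inE; case: (proposalP v) => [->//|[s [? ? ? ?]] _]; exists s.
have cF : #|S st| + #|F| <= #|S new_partner|.
  have dis : S st :&: F = set0.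
    apply/setP => v; rewrite [RHS]inE; apply/negP; rewrite in_setI => /andP[vS /FP[s [[_ _ _ mv _] _ _]]].
    by move: vS; rewrite inE stE mv eqxx.
  rewrite -cardsUI dis cards0 addn0; apply/subset_leq_card/subsetP => v.
  rewrite in_setU => /orP[vS|/FP[s [_ _ E]]]; rewrite inE; last first.
    by apply: (@new_partner_neq v s); split; rewrite ?mem_head.
  have [[u [s cov]]|ncov] := covered_dec v; first exact: new_partner_neq cov.
  by rewrite new_partner_uncovered //; rewrite inE in vS.
split; first lia.
apply: (@leq_trans (#|F| * k.*2)); last by rewrite mulnC leq_mul2l; apply/orP; right; lia.
apply: (@leq_trans (\sum_(v in F) #|[set w | vid N w \in proposal v]|)); last first.
  rewrite -sum_nat_const; apply: leq_sum => v /FP[s [_ sk E]].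
  apply: leq_trans sk; rewrite -[(size s).+1]/(size (v :: s)) cardE.
  apply: uniq_leq_size; first exact: enum_uniq.
  by move=> w; rewrite mem_enum inE E mem_map.
apply: leq_trans (card_bigcup_le _ _); apply/subset_leq_card/subsetP => w.
rewrite inE; have [[v [s [E ws]]] _|ncov] := covered_dec w; last first.
  by rewrite new_partner_uncovered // eqxx.
by apply/bigcupP; exists v; rewrite inE E // mem_map.
Qed.

End Step.

(** * Sweeps over the colour classes *)

Section Iterate.
Variables (k ncol : nat).

Fixpoint partners (col : netfun nat) j : netfun nat :=
  if j is i.+1 then fun G N => new_partner N k (i %% ncol) (col G N) (partners col i N)
  else fun G N v => vid N v.

(** A step collects twice over distance 2k, first the records and then the proposals, which makes 4k
    rounds. *)
Lemma local_partners (col : netfun nat) t j :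
  local t col -> local (t + j * k.*2.*2) (partners col j).
Proof.
move=> lc; elim: j => [|j IH]; first by apply: local_le local_vid.
set t' := t + _ in IH.
have lc' : local t' col by apply: local_le lc; rewrite leq_addr.
have lv : local t' (fun G N v => vid N v) by apply: local_le local_vid.
have lrec := local_walks k.*2 (local_map2 pair lv IH).
have le1 : t' <= t' + k.*2 by rewrite leq_addr.
have lprop := local_map2 (fun cv (W : seq (nat * nat) -> Prop) =>
  if cv == j %% ncol then pick_or [::] (fun P => exists z,
      [/\ W z, augmenting_records z & P = map fst z]) else [::]) (local_le le1 lc') lrec.
have lnew := local_walks k.*2 lprop.
have le2 : t' <= t' + k.*2 + k.*2 by lia.
have -> : t + j.+1 * k.*2.*2 = t' + k.*2 + k.*2 by rewrite /t' mulSn -addnn; lia.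
exact: (local_map2 (fun p (W : seq (seq nat) -> Prop) =>
   pick_or p.2 (fun i => exists z, [/\ W z, p.1 \in last [::] z & i = flip (last [::] z) p.1]))
   (local_le le2 (local_map2 pair lv IH)) lnew).
Qed.

Variables (col : netfun nat) (G : sgraph) (N : network G) (ms : G -> G).
Hypothesis colb : forall v, col N v < ncol.
Hypothesis colP : forall u v, v \in ball (k.*2 + k.*2) u -> u != v -> col N u != col N v.

Let st j := partners col j N.
Let S j := #|[set v | st j v != vid N v]|.
Let changed j := [set v | st j.+1 v != st j v].

Lemma partners_pairing j : exists2 m, pairing m & forall v, st j v = vid N (m v).
Proof.
elim: j => [|j [m mP mE]]; first by exists id => //; split=> // v; rewrite eqxx.
exact: new_partner_pairing mP mE colP.
Qed.

Lemma card_partners_step j : S j <= S j.+1 /\ #|changed j| <= k.*2 * (S j.+1 - S j).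
Proof. by have [m mP mE] := partners_pairing j; exact: card_changed mE colP. Qed.

Lemma card_partners_le i j : i <= j -> S i <= S j.
Proof.
move=> /subnK <-; elim: (j - i) => // n IH.
by apply: leq_trans IH _; have [] := card_partners_step (n + i).
Qed.

Lemma sweep i : pairing ms ->
  k * #|matched ms| <= k.+1 * S (i * ncol) + k.*2 * (k.*2 * (S (i.+1 * ncol) - S (i * ncol))).
Proof.
move=> msP; set j0 := i * ncol.
pose X n := \bigcup_(c < n) changed (j0 + c).
have cX n : #|X n| <= k.*2 * (S (j0 + n) - S j0).
  elim: n => [|n IH]; first by rewrite /X big_ord0 cards0.
  rewrite /X big_ord_recr /=; apply: leq_trans (leq_card_setU _ _) _.
  have [le1 le2] := card_partners_step (j0 + n).
  apply: leq_trans (leq_add IH le2) _; rewrite -mulnDr leq_mul2l; apply/orP; right.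
  have := card_partners_le (leq_addr n j0); rewrite addnS; lia.
have [m mP mE] := partners_pairing j0.
have SE : S j0 = #|matched m|.
  by rewrite /S; apply: eq_card => v; rewrite !inE mE (inj_eq (@vid_inj _ N)).
(* If the sweep touched no vertex of the path, the path would still be augmenting at the turn of
   [v], and then [v] itself changes partner. *)
have hits v s : augmenting m v s -> size s < k.*2 -> exists2 x, x \in X ncol & x \in v :: s.
  move=> aug sk.
  have [[x [xX xs]]|nX] := pselect (exists x, x \in X ncol /\ x \in v :: s); first by exists x.
  have same n u : n <= ncol -> u \in v :: s -> st (j0 + n) u = st j0 u.
    move=> + us; elim: n => [|n IH] ln; first by rewrite addn0.
    rewrite -IH ?(ltnW ln) // addnS; apply/eqP; apply: contraT => ne.
    by case: nX; exists u; split=> //; apply/bigcupP; exists (Ordinal ln); rewrite ?inE.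
  have [mc mcP mcE] := partners_pairing (j0 + col N v).
  have mcm u : u \in v :: s -> mc u = m u.
    move=> us; apply: (@vid_inj _ N); rewrite -mE -mcE; apply: same => //.
    exact/ltnW/colb.
  have augc : augmenting mc v s.
    have [vs us os mv cl] := aug; split=> //; first by rewrite mcm ?mem_head.
    by move=> u uin; rewrite mcm //; exact: cl.
  exists v; rewrite ?mem_head //; apply/bigcupP; exists (Ordinal (colb v)) => //.
  rewrite inE /= /st /=.
  have -> : (j0 + col N v) %% ncol = col N v by rewrite modnMDl modn_small.
  exact: (new_partner_changed mcE colP erefl augc sk).
have := gap mP msP hits; rewrite -SE => h; apply: leq_trans h _.
by rewrite leq_add2l leq_mul2l /j0 mulSn addnC cX orbT.
Qed.

(* A sweep over all colours that starts with a deficit of more than [#|matched ms|]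
   gains more than [#|matched ms| / T] matched vertices, so T sweeps cannot all do so. *)
Lemma partners_approx : 0 < k -> pairing ms -> S ((k.*2 ^ 2) * ncol) <= #|matched ms| ->
  k.-1 * #|matched ms| <= k.+1 * S ((k.*2 ^ 2) * ncol).
Proof.
move=> k0 msP; set T := k.*2 ^ 2; set s := #|matched ms| => sT.
have [//|lt] := leqP (k.-1 * s) (k.+1 * S (T * ncol)).
have H i : i <= T -> i * s.+1 <= T * S (i * ncol).
  elim: i => // i IH iT; have := IH (ltnW iT); have := sweep i msP.
  rewrite mulnA mulnn -/s -/T.
  have mono : S (i.+1 * ncol) <= S (T * ncol) by apply: card_partners_le; rewrite leq_mul2r iT orbT.
  have mono' : S (i * ncol) <= S (i.+1 * ncol) by apply: card_partners_le; rewrite leq_mul2r leqnSn orbT.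
  move: mono mono' lt; move: (S (i * ncol)) (S (i.+1 * ncol)) (S (T * ncol)) => a b t bt ab lt h1 h2.
  (* Sizes only grow, so a shortfall at the end implies one at every earlier sweep; with it, [sweep]
     gives [s < T * (b - a)]. *)
  have at_ : k.+1 * a <= k.+1 * t by rewrite leq_mul2l (leq_trans ab bt) orbT.
  have ks : k * s = k.-1 * s + s by rewrite -{1}(prednK k0) mulSn addnC.
  have h3 : s.+1 <= T * (b - a) by lia.
  by rewrite mulSn -(subnK ab) mulnDr leq_add.
have T0 : 0 < T by rewrite expn_gt0 double_gt0 k0.
have := H T (leqnn _); rewrite leq_pmul2l //; lia.
Qed.

End Iterate.

(** * Numerical estimates *)

Lemma horner_nat_le (p : {poly nat}) : exists c e, forall n, 0 < n -> p.[n]%R <= c * n ^ e.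
Proof.
rewrite /horner; elim: (polyseq p) => [|a s [c [e IH]]]; first by exists 0, 0.
exists (c + a), e.+1 => n n0 /=.
have h : a <= a * n ^ e.+1 by rewrite leq_pmulr // expn_gt0 n0.
rewrite mulnDl; apply: leq_add => //; rewrite expnSr mulnA.
by rewrite leq_mul2r IH // orbT.
Qed.

(** A crude bound linear in [n] suffices: it is compared with [n] itself, the zeroth iterate of
    [log2]. *)
Lemma trunc_log_horner (p : {poly nat}) :
  exists c e, forall n, 0 < n -> trunc_log 2 p.[n]%R <= c + e * n.
Proof.
have [c [e h]] := horner_nat_le p; exists c, e => n n0.
have [->|pn0] := posnP p.[n]%R; first by rewrite trunc_log0.
rewrite -(leq_exp2l (m := 2)) //; apply: leq_trans (trunc_logP _ pn0) _ => //.
apply: leq_trans (h n n0) _; rewrite expnD leq_mul ?(ltnW (ltn_expl _ _)) //.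
rewrite mulnC expnM; case: (e) => // e'; rewrite leq_exp2r //.
by rewrite ltnW // ltn_expl.
Qed.

(** With [2 <= D] all constants move into the exponent: [17 * k ^ 3] costs [8 * k] and [2 ^ a] costs
    [9 * k * K], together at most [17 * K * k]. *)
Lemma color_budget k K D a : 0 < k -> 0 < K -> 1 < D ->
  a <= K * (k.*2.*2 * (trunc_log 2 D).+1).+1 ->
  (k.*2 ^ 2 * 2 ^ a * k.*2.*2).+1 <= D ^ (17 * K * k).
Proof.
move=> k0 K0 D1 ale; set d := k.*2.*2 * _ in ale.
have D0 : 0 < D by exact: ltnW.
have dle : 2 ^ d <= D ^ (8 * k).
  have l1 : 2 ^ (trunc_log 2 D).+1 <= D ^ 2.
    by rewrite expnS -mulnn leq_mul // trunc_logP.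
  have -> : D ^ (8 * k) = (D ^ 2) ^ k.*2.*2 by rewrite -expnM; congr (_ ^ _); lia.
  rewrite /d mulnC expnM; case: (k) k0 => // k' _.
  by rewrite leq_exp2r // doubleS.
have d1le : 2 ^ d.+1 <= D ^ (9 * k).
  have -> : 9 * k = k + 8 * k by lia.
  rewrite expnS expnD leq_mul //; apply: leq_trans D1 _.
  by rewrite -{1}[D]expn1 leq_pexp2l.
have ale2 : 2 ^ a <= D ^ (9 * k * K).
  apply: leq_trans (_ : 2 ^ (K * d.+1) <= _); first by rewrite leq_pexp2l.
  by rewrite mulnC expnM [D ^ _]expnM; case: (K) K0 => // K' _; rewrite leq_exp2r.
have k3 : 17 * k ^ 3 <= D ^ (8 * k).
  apply: (@leq_trans (2 ^ (8 * k))); last by case: (k) k0 => // k' _; rewrite leq_exp2r // mulnS.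
  have -> : 8 * k = 5 * k + k * 3 by lia.
  rewrite expnD leq_mul //.
    by apply: (@leq_trans (2 ^ 5)); rewrite // leq_pexp2l // leq_pmulr.
  by rewrite expnM leq_exp2r // ltnW // ltn_expl.
apply: (@leq_trans (17 * k ^ 3 * 2 ^ a)).
  have : 0 < k ^ 3 * 2 ^ a by rewrite muln_gt0 !expn_gt0 k0.
  have -> : k.*2 ^ 2 * 2 ^ a * k.*2.*2 = 16 * (k ^ 3 * 2 ^ a).
    by rewrite -!muln2 !expnS !expn0; move: (2 ^ a) => x; nia.
  by rewrite -mulnA; move: (_ * 2 ^ a) => x; lia.
apply: leq_trans (leq_mul k3 ale2) _; rewrite -expnD leq_pexp2l //.
nia.
Qed.

Section LogStarBound.
Variable R : realType.
Local Open Scope ring_scope.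

Lemma log_starP (x : R) : iter (log_star x) (@log2 R) x <= 1.
Proof. by rewrite /log_star; case: ex_minnP. Qed.

Lemma lt_log_star (x : R) i : (i < log_star x)%N -> 1 < iter i (@log2 R) x.
Proof.
rewrite /log_star; case: ex_minnP => m _ min im.
by rewrite ltNge; apply/negP => /min; rewrite leqNgt im.
Qed.

Lemma log2_pow2 (x : R) t : 2 ^+ t <= x -> t%:R <= log2 x.
Proof.
have ln2 : 0 < ln (2 : R) by rewrite ln_gt0 ?ltr1n.
move=> h; rewrite /log2 ler_pdivlMr //.
have x0 : 0 < x by apply: lt_le_trans h; rewrite exprn_gt0.
rewrite mulrC mulr_natr -lnXn // ler_ln ?posrE // exprn_gt0 //.
Qed.

Lemma log2M (x y : R) : 0 < x -> 0 < y -> log2 (x * y) = log2 x + log2 y.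
Proof. by move=> x0 y0; rewrite /log2 lnM ?posrE // mulrDl. Qed.

Lemma log2_le_pow2 (x : R) t : 0 < x -> x <= 2 ^+ t -> log2 x <= t%:R.
Proof.
have ln2 : 0 < ln (2 : R) by rewrite ln_gt0 ?ltr1n.
move=> x0 h; rewrite /log2 ler_pdivrMr //.
rewrite mulrC mulr_natr -lnXn // ler_ln ?posrE // exprn_gt0 //.
Qed.

(* Uses [log2 (x + z) <= log2 x + log2 z] for [x, z >= 2]; the exponent [b + 4] makes
   the first summand absorb all terms that do not depend on [y]. *)
Lemma linial_bits_le b d a (y : R) : (0 < b)%N -> (0 < a)%N -> 1 < y ->
  a%:R <= (2 ^ (b + 4) * d.+1)%:R + (2 ^ b)%:R * y ->
  (linial_bits d a)%:R <= (2 ^ (b + 4) * d.+1)%:R + (2 ^ b)%:R * log2 y.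
Proof.
move=> b0 a0 y1 ale.
set K : R := (2 ^ (b + 4) * d.+1)%:R in ale *; set B : R := (2 ^ b)%:R in ale *.
have B2 : 2 <= B by rewrite /B ler_nat -{1}[2%N]expn1 leq_pexp2l.
have K2 : 2 <= K.
  rewrite /K ler_nat; apply: (@leq_trans (2 ^ (b + 4))); last by rewrite leq_pmulr.
  by rewrite -{1}[2%N]expn1 leq_pexp2l // addnS.
have tle : (trunc_log 2 a)%:R <= log2 (K * (B * y)).
  apply: log2_pow2; apply: (@le_trans _ _ (a%:R)).
    by rewrite -natrX ler_nat trunc_logP.
  apply: le_trans ale _; have : 2 <= B * y by nra.
  by move: (B * y) => z z2; nra.
have Kle : log2 K <= (b + 4 + d)%:R.
  apply: log2_le_pow2; first lra.
  by rewrite /K -natrX ler_nat [(2 ^ (_ + d))%N]expnD leq_mul // ltn_expl.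
have Ble : log2 B <= b%:R by apply: log2_le_pow2; [lra|rewrite /B natrX].
have By0 : 0 < B * y by nra.
have y0 : 0 <= log2 y.
  by rewrite -[0]/(0%:R) log2_pow2 // expr0 ltW.
rewrite log2M in tle; [|lra|by []]; rewrite log2M in tle; [|lra|lra].
rewrite /linial_bits -muln2 natrM natrD -natr1.
have hK : 4 * d%:R + 4 * b%:R + 10 <= K.
  rewrite /K -!(natrM, natrD) ler_nat expnD.
  have : (b < 2 ^ b)%N by rewrite ltn_expl.
  by move: (2 ^ b)%N => x bx; nia.
rewrite !natrD in Kle.
have : B * log2 y >= 2 * log2 y by rewrite ler_wpM2r.
lra.
Qed.

(** The bit length after [i] steps stays below a multiple of [d.+1] plus [2 ^ b] times the [i]-th
    iterated logarithm, which is at most 1 after [log_star] steps. Minimality of [log_star] keeps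
    the earlier iterates above 1, as [linial_bits_le] demands. *)
Lemma bits_after_log_star (p : {poly nat}) : exists2 K, (0 < K)%N & forall n d, (1 < n)%N ->
  (iter (log_star (n%:R : R)) (linial_bits d) (trunc_log 2 p.[n]%R).+1 <= K * d.+1)%N.
Proof.
have [c [e h]] := trunc_log_horner p.
pose b := (c + e).+1; exists (2 ^ (b + 4) + 2 ^ b)%N; first by rewrite addn_gt0 expn_gt0.
move=> n d n1; set a := fun i => iter i (linial_bits d) (trunc_log 2 p.[n]%R).+1.
have a0 i : (0 < a i)%N by case: i => // i; exact: linial_bits_gt0.
have H i : (i <= log_star (n%:R : R))%N ->
    (a i)%:R <= (2 ^ (b + 4) * d.+1)%:R + (2 ^ b)%:R * iter i (@log2 R) n%:R.
  elim: i => [_|i IH il].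
    rewrite /= -natrM -natrD ler_nat.
    have hb : (b < 2 ^ b)%N by rewrite ltn_expl.
    apply: leq_trans (_ : c.+1 + e * n <= _)%N; first by rewrite addSn ltnS h // ltnW.
    apply: leq_add; last by rewrite leq_mul2r; apply/orP; right; lia.
    by apply: (@leq_trans (2 ^ (b + 4))); rewrite ?leq_pmulr // expnD; lia.
  rewrite /a !iterS; apply: linial_bits_le => //.
  - exact: a0.
  - exact: lt_log_star.
  exact: IH (ltnW il).
have := H _ (leqnn _) => le; rewrite -(ler_nat R).
apply: le_trans le _; rewrite mulnDl natrD lerD2l.
apply: (@le_trans _ _ (2 ^ b)%:R); last by rewrite ler_nat leq_pmulr.
by rewrite -[leRHS]mulr1 ler_wpM2l // log_starP.
Qed.

End LogStarBound.

(** * Assembling the algorithm *)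

Lemma approx_matching_local (p : {poly nat}) (k t n D : nat) : 0 < k ->
  let d := k.*2.*2 * (trunc_log 2 D).+1 in
  let a := iter t (linial_bits d) (trunc_log 2 p.[n]%R).+1 in
  exists2 f : netfun (pred nat),
    local (t * k.*2.*2 + k.*2 ^ 2 * 2 ^ a * k.*2.*2).+1 f &
    forall (G : sgraph) (N : network G), #|G| = n -> max_degree G = D ->
      (forall v : G, vid N v <= p.[#|G|]%R) ->
      exists M : {set {set G}},
        [/\ forall u v, adj u v -> f G N u (port N u v) = ([set u; v] \in M),
            matching M &
            forall Ms : {set {set G}}, maximum_matching Ms -> k.-1 * #|Ms| <= k.+1 * #|M|].
Proof.
move=> k0 d a.
have [L LP] := choice (linial_step d).
pose bits i := iter i (linial_bits d) (trunc_log 2 p.[n]%R).+1.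
pose col := coloring L bits k.*2.*2 t.
pose T := k.*2 ^ 2 * 2 ^ a.
pose st := partners k (2 ^ a) col T.
have lst := local_partners k (2 ^ a) T (local_coloring L bits k.*2.*2 t).
rewrite -/col -/st in lst.
(* One more round brings the neighbours' identifiers, which translate the partner's identifier into
   a port. *)
exists (fun G N v i => nth false [seq st G N v == j | j <- [seq vid N u | u <- ports N v]] i).
  have lv : local (t * k.*2.*2 + T * k.*2.*2) (fun G N v => vid N v) by apply: local_le local_vid.
  exact: (local_map2 (fun s js i => nth false [seq s == j | j <- js] i)
           (local_le (leqnSn _) lst) (local_nbrs lv)).
move=> G N Gn GD idb.
have vidb v : vid N v < 2 ^ bits 0.
  apply: leq_ltn_trans (idb v) _; rewrite Gn; exact: trunc_log_ltn.
(* [d] is chosen so that the bound [D.+1 ^ k.*2.*2] on balls of radius 4k is at most [2 ^ d]. *)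
have ballb (v : G) : #|ball k.*2.*2 v| <= 2 ^ d.
  apply: leq_trans (card_ball _ _) _; rewrite GD /d mulnC expnM.
  by case: (k) k0 => // k' _; rewrite doubleS leq_exp2r // trunc_log_ltn.
have [colb colP] := coloringP LP (fun i => erefl) t vidb ballb.
rewrite -/col -addnn in colb colP.
have [m mP mE] := partners_pairing (2 ^ a) colP T.
have mdeg u v : adj u v -> ([set u; v] \in pairs m) = (m u == v).
  by move=> uv; rewrite mem_pairs // adj_neq.
exists (pairs m); split; first 1 last.
- exact: matching_pairs.
- move=> Ms [MsM Msmax]; have MM := matching_pairs mP.
  have cM : #|matched m| = #|pairs m|.*2 by rewrite -cover_pairs // card_cover_matching.
  have cMs : #|matched (partner Ms)| = #|Ms|.*2.
    by rewrite matched_partner // card_cover_matching.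
  have SE : #|[set v | st G N v != vid N v]| = #|matched m|.
    by apply: eq_card => v; rewrite !inE /st mE (inj_eq (@vid_inj _ N)).
  have := partners_approx colb colP k0 (pairing_partner MsM).
  rewrite -/T -/st SE cM cMs leq_double => /(_ (Msmax _ MM)).
  by rewrite -!doubleMr leq_double.
move=> u v uv; rewrite mdeg // -map_comp (nth_map u) ?nth_index ?index_mem ?mem_ports //=.
by rewrite /st mE (inj_eq (@vid_inj _ N)).
Qed.

(** Serves graphs of maximum degree at most 1, where all edges are selected without communication;
    there the power of the degree in the round bound is at most 1. *)
Lemma edges_matching (G : sgraph) : (forall v : G, degree v <= 1) -> matching (edges G).
Proof.
move=> deg; split=> //.
have adj_eq (x y z : G) : adj x y -> adj x z -> y = z.
  move=> xy xz; have /card_le1P h := deg x.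
  by have := h y; rewrite inE xy => /(_ isT z); rewrite !inE xz => /esym/eqP.
have other (u v x : G) : adj u v -> x \in [set u; v] -> exists2 y, adj x y & [set u; v] = [set x; y].
  move=> uv; rewrite !inE => /orP[]/eqP->; first by exists v.
  by exists u; [rewrite adj_sym|rewrite setUC].
apply/trivIsetP => _ _ /imset2P[u v _ + ->] /imset2P[u' v' _ + ->].
rewrite !inE => uv uv' ne; rewrite -setI_eq0; apply/eqP/setP => x.
rewrite [RHS]inE; apply/negP; rewrite in_setI => /andP[/(other _ _ _ uv)[y xy E] /(other _ _ _ uv')[z xz E']].
by move: ne; rewrite E E' (adj_eq x y z) // eqxx.
Qed.

Local Open Scope ring_scope.

Theorem theorem20 (R : realType) (p : {poly nat}) :
  exists C1 C2 : R, 0 < C1 /\ 0 < C2 /\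
    forall eps : R, 0 < eps -> eps < 1 ->
    exists (A : algorithm) (r : nat -> nat -> nat),
      (forall n D : nat,
         (r n D)%:R <= D%:R `^ (C1 / eps)
                       + C2 / eps ^+ 2 * (log_star (n%:R : R))%:R) /\
      (forall (G : sgraph) (N : network G),
         (forall v : G, (vid N v <= p.[#|G|])%N) ->
         exists M : {set {set G}},
           [/\ outputs_edge_set A N (r #|G| (max_degree G)) M,
               matching M &
               forall Mstar : {set {set G}}, maximum_matching Mstar ->
                 (1 - eps) * #|Mstar|%:R <= #|M|%:R]).
Proof.
have [K K0 KP] := bits_after_log_star R p.
(* [k <= 2 / eps] turns the exponent [17 * K * k] of [color_budget] into at most [34 * K / eps], and
   one colour reduction takes [4 * k <= 8 / eps <= 8 / eps ^+ 2] rounds. *)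
exists (34 * K%:R), 8; split; first by rewrite mulr_gt0 ?ltr0n.
split=> // eps e0 e1.
(* Rounding down keeps [k <= 2 / eps], while [2 / eps < k + 1] makes [(k - 1) / (k + 1)] exceed
   [1 - eps]. *)
pose k := Num.truncn (2 / eps).
have e2 : 2 <= 2 / eps by rewrite ler_pdivlMr //; lra.
have /andP[kle klt] : k%:R <= 2 / eps < k.+1%:R by rewrite truncn_itv // (le_trans _ e2).
have k0 : (0 < k)%N by rewrite -ltnS -(ltr_nat R); apply: le_lt_trans klt; lra.
pose t n := log_star (n%:R : R).
pose d D := (k.*2.*2 * (trunc_log 2 D).+1)%N.
pose a n D := iter (t n) (linial_bits (d D)) (trunc_log 2 p.[n]%R).+1.
pose r n D := if (1 < n)%N && (1 < D)%N then
  (t n * k.*2.*2 + k.*2 ^ 2 * 2 ^ a n D * k.*2.*2).+1 else 0%N.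
have solve (nD : nat * nat) : exists F : view -> pred nat,
    forall (G : sgraph) (N : network G), #|G| = nD.1 -> max_degree G = nD.2 ->
      (forall v : G, (vid N v <= p.[#|G|])%N) ->
      exists M : {set {set G}},
        [/\ forall u v, adj u v ->
              F (views N (r nD.1 nD.2) u) (port N u v) = ([set u; v] \in M),
            matching M &
            forall Ms : {set {set G}}, maximum_matching Ms -> (1 - eps) * #|Ms|%:R <= #|M|%:R].
  case: nD => n D /=; rewrite /r; case: ifP => nD1.
    have [f [F fF] fP] := approx_matching_local p (t n) n D k0.
    exists F => G N Gn GD idb; have [M [Mout MM Mapp]] := fP G N Gn GD idb.
    exists M; split=> // [u v uv|Ms /Mapp]; first by rewrite -fF Mout.
    rewrite -(ler_nat R) !natrM => le.
    have k1 : 0 < k.+1%:R :> R by rewrite ltr0n.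
    rewrite -(ler_pM2l k1); apply: le_trans le; rewrite mulrA ler_wpM2r //.
    have -> : k.-1%:R = k.+1%:R - 2 :> R by rewrite -{2}(prednK k0) -!natr1; lra.
    move: klt; rewrite ltr_pdivrMr // => klt; lra.
  exists (fun _ _ => true) => G N Gn GD _; exists (edges G); split.
  - by move=> u v uv; rewrite mem_edges uv.
  - apply: edges_matching => v; move/negbT: nD1; rewrite negb_and -!leqNgt => /orP[n1|D1].
      by apply: leq_trans n1; rewrite -Gn max_card.
    by apply: leq_trans D1; rewrite -GD; exact: leq_bigmax.
  move=> Ms [[MsE _] _]; have := subset_leq_card MsE; rewrite -(ler_nat R).
  have := ler0n R #|Ms|; nra.
(* Each pair of order and maximum degree has its own output function; a vertex reads both from its
   input, so one algorithm serves all graphs. *)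
have [F FP] := choice solve.
exists (collect (fun s => F (in_order (view_input s), in_max_degree (view_input s)) s)), r.
split=> [n D|G N idb]; last first.
  have [M [Mout MM Mapp]] := FP (#|G|, max_degree G) G N erefl erefl idb.
  exists M; split=> // u v uv; rewrite run_collect.
  by rewrite /= view_input_views; exact: Mout.
have C2pos : 0 <= 8 / eps ^+ 2 * (log_star (n%:R : R))%:R.
  by rewrite mulr_ge0 // divr_ge0 // exprn_ge0 // ltW.
rewrite /r; case: ifP => [/andP[n1 D1]|_]; last by rewrite addr_ge0 ?powR_ge0.
(* The extra round is charged to the sweeps, where [color_budget] has room for it. *)
rewrite -addnS natrD addrC lerD //.
  apply: (@le_trans _ _ (D ^ (17 * K * k))%:R).
    by rewrite ler_nat color_budget // KP.
  rewrite natrX -powR_mulrn // ler_powR // ?ler1n ?(ltnW D1) //.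
  rewrite natrM; have -> : 34 * K%:R / eps = (17 * K)%:R * (2 / eps) :> R.
    by rewrite natrM; lra.
  by rewrite ler_wpM2l.
rewrite -/(t n) natrM mulrC ler_wpM2r //.
have -> : k.*2.*2%:R = 4 * k%:R :> R by rewrite -!muln2 !natrM; lra.
rewrite ler_pdivlMr ?exprn_gt0 //.
move: kle; rewrite ler_pdivlMr // => kle.
rewrite expr2; nra.
Qed.
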